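(* A class of graphs $\mathcal{X}$ is a function of $\mathcal{D}_1$ if and only if there exists $k\in\mathbb{N}$ such that $\mathcal{X}\subseteq\mathcal{D}_k\cup\overline{\mathcal{D}_k}$.
   Context: All graphs are finite and simple; a class of graphs is a set of graphs closed under isomorphism. For $k\in\mathbb{N}$, $\mathcal{D}_k$ is the class of graphs of maximum degree at most $k$, and $\overline{\mathcal{D}_k}$ is the class of complements of graphs in $\mathcal{D}_k$. For a graph $G$ and distinct vertices $u,w$, $G(u,w)=1$ if they are adjacent and $0$ otherwise. If $G,H_1,\dots,H_k$ are graphs on the same vertex set $V$, $G$ is a (boolean) function of $H_1,\dots,H_k$ if there is a boolean function $f:\{0,1\}^k\to\{0,1\}$ with $G(a,b)=f(H_1(a,b),\dots,H_k(a,b))$ for all distinct $a,b\in V$. A class $\mathcal{Y}$ is a $k$-function of $\mathcal{X}$ if every $G\in\mathcal{Y}$ is a function of at most $k$ graphs from $\mathcal{X}$ (on the vertex set of $G$); $\mathcal{Y}$ is a function of $\mathcal{X}$ if it is a $k$-function for some $k\in\mathbb{N}$. *)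

(* Defs.v *)
From mathcomp Require Import all_boot.

Set Implicit Arguments.
Unset Strict Implicit.
Unset Printing Implicit Defensive.

Record sgraph (V : finType) := SGraph {
  adj :> rel V;
  adj_sym : symmetric adj;
  adj_irr : irreflexive adj }.

Definition graph_iso (V W : finType) (G : sgraph V) (H : sgraph W) : Prop :=
  exists2 f : V -> W, bijective f & forall x y, H (f x) (f y) = G x y.

Record graph_class := GraphClass {
  in_class :> forall V : finType, sgraph V -> Prop;
  class_iso : forall (V W : finType) (G : sgraph V) (H : sgraph W),
    graph_iso G H -> in_class G -> in_class H }.

Definition degree (V : finType) (G : sgraph V) (x : V) : nat :=
  #|[set y | G x y]|.

(* The graph without vertices has maximum degree 0. *)
Definition max_degree (V : finType) (G : sgraph V) : nat :=
  \max_(x : V) degree G x.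

Lemma degree_iso (V W : finType) (G : sgraph V) (H : sgraph W) (f : V -> W) :
  bijective f -> (forall x y, H (f x) (f y) = G x y) ->
  forall x, degree H (f x) = degree G x.
Proof.
move=> bf fE x; rewrite /degree -(card_imset [set y | G x y] (bij_inj bf)).
congr #|pred_of_set _|; apply/setP=> z; rewrite inE.
case: bf => g fK gK; apply/idP/imsetP.
  by move=> Hz; exists (g z); rewrite ?gK // inE -fE gK.
by case=> y; rewrite inE => Gxy ->; rewrite fE.
Qed.

Lemma max_degree_iso k (V W : finType) (G : sgraph V) (H : sgraph W) :
  graph_iso G H -> max_degree G <= k -> max_degree H <= k.
Proof.
case=> f bf fE /bigmax_leqP Gk; apply/bigmax_leqP => z _.
by case: (bf) => g _ gK; rewrite -(gK z) (degree_iso bf fE) Gk.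
Qed.

Definition bounded_degree (k : nat) : graph_class :=
  @GraphClass (fun V G => max_degree G <= k) (@max_degree_iso k).

Definition compl_rel (V : finType) (G : sgraph V) : rel V :=
  fun x y => (x != y) && ~~ G x y.

Lemma compl_rel_sym (V : finType) (G : sgraph V) : symmetric (compl_rel G).
Proof. by move=> x y; rewrite /compl_rel eq_sym adj_sym. Qed.

Lemma compl_rel_irr (V : finType) (G : sgraph V) : irreflexive (compl_rel G).
Proof. by move=> x; rewrite /compl_rel eqxx. Qed.

Definition compl (V : finType) (G : sgraph V) : sgraph V :=
  SGraph (@compl_rel_sym V G) (@compl_rel_irr V G).

(* Equality of graphs on the same vertex set is expressed by [=2]. *)
Definition in_compl_class (X : graph_class) (V : finType) (G : sgraph V) :
    Prop :=
  exists2 H : sgraph V, X V H & G =2 compl H.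

Lemma in_compl_class_iso (X : graph_class) (V W : finType)
    (G : sgraph V) (H : sgraph W) :
  graph_iso G H -> in_compl_class X G -> in_compl_class X H.
Proof.
case=> f [g fK gK] fE [K XK GE].
have symK : symmetric (fun x y => K (g x) (g y)) by move=> x y; exact: adj_sym.
have irrK : irreflexive (fun x y => K (g x) (g y)) by move=> x; exact: adj_irr.
exists (SGraph symK irrK).
  apply: class_iso XK; exists f; first by exists g.
  by move=> x y /=; rewrite !fK.
move=> x y; rewrite -[x in LHS]gK -[y in LHS]gK fE GE /= /compl_rel /=.
by rewrite (inj_eq (can_inj gK)).
Qed.

Definition compl_class (X : graph_class) : graph_class :=
  GraphClass (@in_compl_class_iso X).

Definition graph_function (V : finType) (G : sgraph V) (j : nat)
    (H : 'I_j -> sgraph V) : Prop :=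
  exists f : {ffun 'I_j -> bool} -> bool,
    forall a b : V, a != b -> G a b = f [ffun i => H i a b].

Definition kfunction_of (k : nat) (Y X : graph_class) : Prop :=
  forall (V : finType) (G : sgraph V), Y V G ->
  exists j : nat, j <= k /\
  exists H : 'I_j -> sgraph V, (forall i, X V (H i)) /\ graph_function G H.

Definition function_of (Y X : graph_class) : Prop :=
  exists k : nat, kfunction_of k Y X.

(* Main.v *)
Require Import Defs.
From mathcomp Require Import all_boot.

Set Implicit Arguments.
Unset Strict Implicit.
Unset Printing Implicit Defensive.

(** If [f] is the boolean function and [f 0 = 0], every edge of [G] is an edge of
    one of the [k] matchings, so degrees are at most [k]; if [f 0 = 1], the same
    holds for the complement.  Conversely, a graph of maximum degree [k] is the
    union of [2k] matchings: every edge outside a maximal matching meets that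
    matching, so removing it decreases [deg x + deg y] for each remaining edge
    [xy], and repeating this [2k] times leaves no edge. *)

Section MaximalMatching.

Variables (V : finType) (G : sgraph V).

(** A matching is a symmetric set of ordered pairs, with a boolean predicate, so that a maximal one
    exists by finiteness of the power set. *)
Definition matching (M : {set V * V}) : bool :=
  [forall x, forall y, ((x, y) \in M) ==> G x y && ((y, x) \in M)] &&
  [forall x, forall y, forall z,
     ((x, y) \in M) && ((x, z) \in M) ==> (y == z)].

Lemma matchingP (M : {set V * V}) :
  reflect ((forall x y, (x, y) \in M -> G x y /\ (y, x) \in M) /\
           (forall x y z, (x, y) \in M -> (x, z) \in M -> y = z))
          (matching M).
Proof.
apply: (iffP andP) => [[/forallP M1 /forallP M2]|[M1 M2]]; split.
- by move=> x y Mxy; move/forallP/(_ y)/implyP/(_ Mxy)/andP: (M1 x).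
- move=> x y z Mxy Mxz.
  by move/forallP/(_ y)/forallP/(_ z): (M2 x); rewrite Mxy Mxz => /eqP.
- apply/forallP=> x; apply/forallP=> y; apply/implyP=> /M1 [-> ->] //.
- apply/forallP=> x; apply/forallP=> y; apply/forallP=> z.
  by apply/implyP=> /andP[Mxy Mxz]; apply/eqP/(M2 x).
Qed.

Lemma matching_add (M : {set V * V}) (x y : V) :
    matching M -> G x y ->
    (forall z, (x, z) \notin M) -> (forall z, (y, z) \notin M) ->
  matching (M :|: [set (x, y); (y, x)]).
Proof.
move=> /matchingP[M1 M2] Gxy Mx My.
have xDy : x != y by apply: contraTneq Gxy => ->; rewrite adj_irr.
apply/matchingP; split.
  move=> a b; rewrite !inE !xpair_eqE => /orP[/M1[-> ->] //|].
  case/orP=> /andP[/eqP-> /eqP->]; rewrite !eqxx ?orbT //.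
  by rewrite adj_sym.
move=> a b c; rewrite !inE !xpair_eqE.
case/orP=> [Mab|/orP[]/andP[/eqP-> /eqP->]];
  case/orP=> [Mac|/orP[]/andP[/eqP aE /eqP->]] //.
- exact: M2 Mab Mac.
- by move: (Mx b); rewrite -aE Mab.
- by move: (My b); rewrite -aE Mab.
- by rewrite (negPf (Mx c)) in Mac.
- by rewrite (negPf (My c)) in Mac.
Qed.

(** Maximality is recorded in the form used later: an edge of [G] with both ends unmatched could be
    added to the matching. *)
Lemma exists_maximal_matching :
  exists2 M : sgraph V, max_degree M <= 1 &
    (forall x y, M x y -> G x y) /\
    (forall x y, G x y -> exists z, M x z || M y z).
Proof.
have m0 : matching set0.
  by apply/matchingP; split=> [x y|x y z]; rewrite inE.
have [M /maxsetP[mM maxM]] := ex_maxset (ex_intro _ set0 m0).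
have [M1 M2] := matchingP _ mM.
have sM : symmetric (fun x y => (x, y) \in M).
  by move=> x y; apply/idP/idP => /M1[].
have iM : irreflexive (fun x y => (x, y) \in M).
  by move=> x; apply/negP=> /M1[]; rewrite adj_irr.
exists (SGraph sM iM).
  apply/bigmax_leqP=> x _; apply/card_le1_eqP=> y z.
  by rewrite !inE /= => Mxy Mxz; exact: M2 Mxz Mxy.
split=> [x y /M1[]//|x y Gxy /=]; apply/existsP; apply: contraT.
rewrite negb_exists => /forallP Mxy.
have {}Mxy z : ((x, z) \notin M) * ((y, z) \notin M).
  by have := Mxy z; rewrite negb_or => /andP[-> ->].
(* By maximality the enlarged matching equals [M], so [(x, y)] is already in [M], although [x] and
   [y] are unmatched. *)
have := maxM _ (matching_add mM Gxy (fun z => (Mxy z).1) (fun z => (Mxy z).2))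
  (subsetUl _ _).
by move/setP/(_ (x, y)); rewrite !inE eqxx orbT (negPf (Mxy y).1).
Qed.

End MaximalMatching.

Section Difference.

Variables (V : finType) (G M : sgraph V).

Definition diff_rel : rel V := fun x y => G x y && ~~ M x y.

Lemma diff_rel_sym : symmetric diff_rel.
Proof. by move=> x y; rewrite /diff_rel !(adj_sym _ x). Qed.

Lemma diff_rel_irr : irreflexive diff_rel.
Proof. by move=> x; rewrite /diff_rel adj_irr. Qed.

Definition diff_graph : sgraph V := SGraph diff_rel_sym diff_rel_irr.

Lemma degree_diff_le x : degree diff_graph x <= degree G x.
Proof. by apply/subset_leq_card/subsetP=> y; rewrite !inE => /andP[]. Qed.

Lemma degree_diff_lt x z : G x z -> M x z -> degree diff_graph x < degree G x.
Proof.
move=> Gxz Mxz; apply/proper_card/properP; split.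
  by apply/subsetP=> y; rewrite !inE => /andP[].
by exists z; rewrite !inE //= /diff_rel Mxz andbF.
Qed.

End Difference.

(** Induction on [n], peeling off one maximal matching. The measure is the degree sum along edges,
    since the maximum degree may survive the removal at an unmatched vertex. *)
Lemma union_of_matchings n (V : finType) (G : sgraph V) :
    (forall x y, G x y -> degree G x + degree G y <= n) ->
  exists2 H : 'I_n -> sgraph V, (forall i, max_degree (H i) <= 1) &
    forall x y, G x y = [exists i, H i x y].
Proof.
elim: n => [|n IHn] in G *.
  (* The family over ['I_0] is empty, so [G] is only a filler; an edge would have an end of degree
     0. *)
  move=> degG; exists (fun=> G) => [[]//|x y].
  transitivity false; last by apply/esym/existsP=> -[[]].
  apply/negP=> Gxy; move: (degG x y Gxy).
  rewrite leqn0 addn_eq0 cards_eq0 => /andP[/eqP/setP/(_ y)].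
  by rewrite !inE Gxy.
move=> degG; have [M M1 [MG maxM]] := exists_maximal_matching G.
have [|H H1 HE] := IHn (diff_graph G M).
  move=> x y /andP[Gxy _]; rewrite -ltnS; apply: leq_trans (degG x y Gxy).
  (* The matched end loses a neighbour, and the other end gains none. *)
  have [z /orP[] Mz] := maxM x y Gxy.
    by rewrite -addSn leq_add ?degree_diff_le // (@degree_diff_lt _ _ _ _ z) ?MG.
  by rewrite -addnS leq_add ?degree_diff_le // (@degree_diff_lt _ _ _ _ z) ?MG.
exists (fun i => if unlift ord0 i is Some j then H j else M) => [i|x y].
  by case: unliftP.
have GE : G x y = M x y || diff_graph G M x y.
  by rewrite /= /diff_rel; case: (boolP (M x y)) => [/MG->|_]; rewrite ?andbT.
rewrite GE HE; apply/idP/existsP => [/orP[Mxy|/existsP[i Hi]]|[i]].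
- by exists ord0; rewrite unlift_none.
- by exists (lift ord0 i); rewrite liftK.
- by case: unliftP => [j _ Hj|_ ->//]; apply/orP; right; apply/existsP; exists j.
Qed.

Lemma bounded_degree_union_of_matchings k (V : finType) (G : sgraph V) :
    max_degree G <= k ->
  exists2 H : 'I_(k + k) -> sgraph V, (forall i, max_degree (H i) <= 1) &
    forall x y, G x y = [exists i, H i x y].
Proof.
move=> /bigmax_leqP Gk; apply: union_of_matchings => x y _.
by rewrite leq_add ?Gk.
Qed.

(** Each neighbourhood in [G] lies in a union of [j] neighbourhoods of size at most 1. *)
Lemma max_degree_covered j (V : finType) (G : sgraph V)
    (H : 'I_j -> sgraph V) :
    (forall i, max_degree (H i) <= 1) ->
    (forall x y, G x y -> exists i, H i x y) ->
  max_degree G <= j.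
Proof.
move=> H1 GH; apply/bigmax_leqP=> x _.
have sub : [set y | G x y] \subset \bigcup_(i < j) [set y | H i x y].
  apply/subsetP=> y; rewrite inE => /GH[i Hi].
  by apply/bigcupP; exists i; rewrite ?inE.
apply: leq_trans (subset_leq_card sub) _.
have jE : \sum_(i < j) 1 = j by rewrite sum1_card card_ord.
rewrite -[leqRHS]jE.
apply: (big_ind2 (fun (A : {set V}) n => #|A| <= n)) => [|A m B n Am Bn|i _].
- by rewrite cards0.
- by rewrite (leq_trans (leq_card_setU A B)) ?leq_add.
- by move/bigmax_leqP: (H1 i); apply.
Qed.

Theorem theorem4p12 (X : graph_class) :
  function_of X (bounded_degree 1) <->
  exists k : nat, forall (V : finType) (G : sgraph V),
    X V G -> bounded_degree k V G \/ compl_class (bounded_degree k) V G.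
Proof.
split=> -[k Xk].
  exists k => V G /Xk[j [jk [H [H1 [f fE]]]]].
  (* A pair that no [H i] joins gets the value of [f] at the zero vector. *)
  have some_edge a b : a != b -> G a b != f [ffun=> false] ->
      exists i, H i a b.
    move=> aDb; rewrite fE // => fD; apply/existsP; apply: contraNT fD.
    rewrite negb_exists => /forallP Hab; apply/eqP; congr f.
    by apply/ffunP=> i; rewrite !ffunE (negPf (Hab i)).
  case f0: (f [ffun=> false]) some_edge => some_edge.
    right; exists (compl G).
      apply: leq_trans jk; apply: max_degree_covered H1 _ => x y /andP[xDy nG].
      by apply: some_edge; rewrite // (negPf nG).
    (* Complementing twice gives [G] back; on the diagonal both sides are false. *)
    move=> x y /=; rewrite /compl_rel /= /compl_rel.
    by case: eqP => [->|_]; rewrite ?adj_irr //= negbK.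
  left; apply: leq_trans jk; apply: max_degree_covered H1 _ => x y Gxy.
  apply: some_edge; last by rewrite Gxy.
  by apply: contraTneq Gxy => ->; rewrite adj_irr.
(* [k + k] bounds the degree sum of an edge. The boolean function is disjunction for [G] itself, and
   its negation when the complement is decomposed. *)
exists (k + k) => V G /Xk[Gk|[G' G'k GE]].
  have [H H1 HE] := bounded_degree_union_of_matchings Gk.
  exists (k + k); split=> //; exists H; split=> //.
  exists (fun h => [exists i, h i]) => a b _; rewrite HE.
  by apply: eq_existsb => i; rewrite ffunE.
have [H H1 HE] := bounded_degree_union_of_matchings G'k.
exists (k + k); split=> //; exists H; split=> //.
exists (fun h => ~~ [exists i, h i]) => a b aDb.
rewrite GE /= /compl_rel aDb HE; congr (~~ _).
by apply: eq_existsb => i; rewrite ffunE.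
Qed.
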